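(* Assume $n\ge3$. Let $M$ be an $n$-compartment cycle model with $In=\{1\}$ and $Out=\{p\}$ (for some $1\le p\le n$). If there exist leaks $i,j\in Leak$ with $i\ne j$ such that $i\ge p$ and $j\ge p$, then $M$ is not generically locally identifiable.
   Context: A linear compartmental model $(G,In,Out,Leak)$ consists of a directed graph $G=(V,E)$ with $V=\{1,\dots,n\}$ (vertices are called compartments) and subsets $In,Out,Leak\subseteq V$. Each edge $j\to i$ has a parameter $k_{ij}$, and each $j\in Leak$ has a parameter $k_{0j}$. The compartmental matrix $A$ is the $n\times n$ matrix with off-diagonal entries $A_{ij}=k_{ij}$ if $j\to i\in E$ and $0$ otherwise, and diagonal entries $A_{ii}=-\sum_{q:\,i\to q\in E}k_{qi}$ if $i\notin Leak$, $A_{ii}=-k_{0i}-\sum_{q:\,i\to q\in E}k_{qi}$ if $i\in Leak$. Let $\partial I$ be the $n\times n$ diagonal matrix with all diagonal entries the differential operator $d/dt$, and let $(B)_{ji}$ denote $B$ with row $j$ and column $i$ removed. The input-output equations are, for $i\in Out$, $$\det(\partial I-A)\,y_i=\sum_{j\in In}(-1)^{i+j}\det\big((\partial I-A)_{ji}\big)\,u_j ,$$ with both sides expanded in powers of $d/dt$ (i.e., in derivatives of the $y_i$ and $u_j$). The coefficient map $c:\mathbb{R}^{|E|+|Leak|}\to\mathbb{R}^m$ sends the vector of parameters to the vector of all non-monic coefficients of these equations (coefficients identically equal to $1$ are omitted, as are coefficients identically $0$). A strongly connected model with at least one input is generically locally identifiable if, outside a set of measure zero, every point of $\mathbb{R}^{|E|+|Leak|}$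 has an open neighborhood $U$ such that $c|_U$ is one-to-one. An $n$-compartment cycle model is a linear compartmental model whose graph $G$ is the directed cycle with edges $1\to2\to3\to\cdots\to n\to1$ (parameters $k_{21},k_{32},\dots,k_{n,n-1},k_{1n}$). *)

(* Defs.v *)
(* Compartment i of {1, ..., n} is the ordinal
   of value i - 1 in 'I_n. *)
From HB Require Import structures.
From mathcomp Require Import all_boot all_order all_algebra.
From mathcomp Require Import all_classical all_reals all_analysis.
Import numFieldNormedType.Exports.
Set Implicit Arguments.
Unset Strict Implicit.
Unset Printing Implicit Defensive.
Import Order.TTheory GRing.Theory Num.Theory.
Local Open Scope ring_scope.

(* The pair (j, i) stands for the edge j -> i. *)
Record lc_model (n : nat) := LCModel {
  edges : {set 'I_n * 'I_n};
  inputs : {set 'I_n};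
  outputs : {set 'I_n};
  leaks : {set 'I_n};
  edges_irrefl : forall i, (i, i) \notin edges }.

Section Model.
Context (R : realType) (n : nat) (M : lc_model n).

Definition nparams : nat := (#|edges M| + #|leaks M|)%N.

(* A parameter vector lists the k_{ij} in the order of [enum (edges M)],
   followed by the k_{0j} in the order of [enum (leaks M)].  The sums below
   have exactly one term when the edge j -> i (resp. the leak j) exists, and
   are empty otherwise. *)
Definition edge_param (t : 'rV[R]_nparams) (i j : 'I_n) : R :=
  \sum_(l < #|edges M| | enum_val l == (j, i)) t 0 (lshift #|leaks M| l).

Definition leak_param (t : 'rV[R]_nparams) (j : 'I_n) : R :=
  \sum_(l < #|leaks M| | enum_val l == j) t 0 (rshift #|edges M| l).

Definition comp_mx (t : 'rV[R]_nparams) : 'M[R]_n :=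
  \matrix_(i, j)
    if i == j then
      (if i \in leaks M then - leak_param t i else 0)
      - \sum_(q | (i, q) \in edges M) edge_param t q i
    else if (j, i) \in edges M then edge_param t i j else 0.

(* The operator d/dt is the indeterminate 'X, so that [char_poly_mx A] is
   dI - A. *)
Definition io_lhs (t : 'rV[R]_nparams) : {poly R} :=
  \det (char_poly_mx (comp_mx t)).

(* [cofactor B j i] is (-1)^(i+j) times the determinant of B with row j and
   column i removed; shifting both indices by 1 does not change the sign. *)
Definition io_rhs (i j : 'I_n) (t : 'rV[R]_nparams) : {poly R} :=
  cofactor (char_poly_mx (comp_mx t)) j i.

(* The left-hand side has degree n and the right-hand side has degree less
   than n, so all coefficients are listed. *)
Definition io_coefs : seq ('rV[R]_nparams -> R) :=
  [seq (fun t => (io_lhs t)`_d) | i <- enum (outputs M), d <- iota 0 n.+1] ++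
  [seq (fun t => (io_rhs ij.1 ij.2 t)`_d)
     | ij <- enum (finset.setX (outputs M) (inputs M)), d <- iota 0 n].

Definition kept_coefs : seq ('rV[R]_nparams -> R) :=
  [seq f <- io_coefs |
     ~~ `[< forall t, f t = 0 >] && ~~ `[< forall t, f t = 1 >]].

Definition coefficient_map (t : 'rV[R]_nparams) : 'rV[R]_(size kept_coefs) :=
  \row_l nth (fun=> 0) kept_coefs l t.

End Model.

(* Lebesgue-null subsets of R^d: for every e > 0 there is a countable cover by
   closed boxes of total volume less than e.  The family is indexed by a set D
   of naturals, so that it may be finite or empty: for d = 0 every box has
   volume 1, and only the empty set is null. *)
Definition lebesgue_null (R : realType) (d : nat) (N : set 'rV[R]_d) : Prop :=
  forall e : R, 0 < e ->
  exists (D : set nat) (a b : nat -> 'rV[R]_d),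
    [/\ forall k l, a k 0 l <= b k 0 l,
        forall x, N x -> exists2 k, D k & forall l, a k 0 l <= x 0 l <= b k 0 l
      & (\esum_(k in D) (\prod_l (b k 0 l - a k 0 l))%:E < e%:E)%E].

(* Only meaningful for strongly connected models with at least one input; see
   [cycle_model_strongly_connected] for cycle models. *)
Definition generically_locally_identifiable (R : realType) (n : nat)
    (M : lc_model n) : Prop :=
  exists2 N : set 'rV[R]_(nparams M), lebesgue_null N &
    forall t, ~ N t -> exists U : set 'rV[R]_(nparams M),
      [/\ open U, U t & set_inj U (@coefficient_map R n M)].

Definition strongly_connected (n : nat) (M : lc_model n) : Prop :=
  forall i j : 'I_n, connect [rel x y | (x, y) \in edges M] i j.

(* [ordS] is the cyclic successor on 'I_n. *)
Definition cycle_model (n : nat) (M : lc_model n) : Prop :=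
  edges M = [set (i, ordS i) | i : 'I_n]%SET.

Lemma cycle_model_strongly_connected (n : nat) (M : lc_model n) :
  cycle_model M -> strongly_connected M.
Proof.
move=> cM i j; pose e := [rel x y | (x, y) \in edges M].
have eS x : e x (ordS x) by rewrite /= cM; apply/imsetP; exists x.
have conn_iter k x : connect e x (iter k (@ordS n) x).
  by elim: k => //= k IHk; apply: connect_trans IHk (connect1 (eS _)).
have iterE k x : iter k (@ordS n) x = ((x + k) %% n)%N :> nat.
  elim: k => [|k /= ->]; first by rewrite addn0 modn_small.
  by rewrite addnS -[in LHS]addn1 -[in RHS]addn1 modnDml.
suff -> : j = iter (j + (n - i))%N (@ordS n) i by [].
apply: val_inj; rewrite /= iterE addnCA subnKC ?(ltnW (ltn_ord i)) //.
by rewrite modnDr modn_small.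
Qed.

(* Main.v *)
Require Import Defs.
From mathcomp Require Import all_boot all_order all_algebra.
From mathcomp Require Import all_classical all_reals all_analysis.
From mathcomp Require Import measurable_realfun.
From mathcomp Require Import ring zify.
Set Implicit Arguments.
Unset Strict Implicit.
Unset Printing Implicit Defensive.
Import Order.TTheory GRing.Theory Num.Theory.
Import numFieldNormedType.Exports.
Local Open Scope classical_set_scope.
Local Open Scope ring_scope.

(** Conjugating the compartmental matrix A of a cycle by an invertible diagonal
matrix diag(d) leaves det(xI - A) unchanged and multiplies the (p, q) entry of
the adjugate of xI - A by d_p / d_q; if d_p = d_q for the output p and the
input q, no coefficient of the input-output equation changes.  The conjugate is
again the matrix of the same model as soon as d only jumps along edges that
leave a leak: the edge parameter of v -> v+1 gets multiplied by
d_{v+1} / d_v, and the leak parameter of v absorbs the difference so that the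
diagonal entry keeps its value.  This is [coefficient_map_rescale].

Let i < j be two leaks with p <= i.  Taking d = s on the arc i+1, ..., j and
d = 1 elsewhere, d jumps only along the edges leaving i and j, and d = 1 at
both p and compartment 1.  So s parametrizes a curve in a fibre of the
coefficient map, passing through the original parameters at s = 1; it is not
constant when k_{i+1,i} is nonzero.  The coefficient map is thus not injective
near any point with k_{i+1,i} <> 0.

It remains to find such a point outside the exceptional null set.  A null set
cannot contain the cube [1, 2]^d, because closed boxes covering a unit cube
have total volume at least 1 ([cube_cover_volume_ge1]). *)

(** * Null sets do not contain cubes *)

(** By induction on the dimension and Tonelli: for each y in [m, m + 1], the
volumes of the sections at height y of the boxes add up to at least 1, and
integrating these sums over y gives at most the total volume. *)
Lemma cube_cover_volume_ge1 (R : realType) (d : nat) (m : R) (D : set nat)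
    (a b : nat -> 'I_d -> R) :
  (forall k l, a k l <= b k l) ->
  (forall x : 'I_d -> R, (forall l, m <= x l <= m + 1) ->
     exists2 k, D k & forall l, a k l <= x l <= b k l) ->
  (1 <= \esum_(k in D) (\prod_l (b k l - a k l))%:E)%E.
Proof.
elim: d D a b => [|d IHd] D a b ab cov.
  have [|k Dk _] := cov (fun=> m); first by case.
  apply: esum_ge; exists [set k]; first by split => // _ ->.
  by rewrite fsbig_set1 big_ord0.
pose v k := \prod_l (b k (lift ord0 l) - a k (lift ord0 l)).
have v_ge0 k : 0 <= v k by apply: prodr_ge0 => l _; rewrite subr_ge0.
pose c k := if k \in D then v k else 0.
have c_ge0 k : 0 <= c k by rewrite /c; case: ifP.
pose I k : set (measurableTypeR R) := `[a k ord0, b k ord0]%classic.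
have mI k : measurable (I k) by exact: measurable_itv.
pose J : set (measurableTypeR R) := `[m, m + 1]%classic.
have mJ : measurable J by exact: measurable_itv.
pose g k (y : measurableTypeR R) : \bar R := ((c k)%:E * (\1_(I k) y)%:E)%E.
have g_ge0 k y : (0 <= g k y)%E by rewrite mule_ge0 ?lee_fin.
have mg k : measurable_fun J (g k).
  apply: measurable_funeM; apply/measurable_EFinP.
  exact: measurable_indic.
(* The boxes meeting the hyperplane of first coordinate y cut it in boxes that
   cover a cube of one dimension less. *)
have slice y : J y -> (1 <= \sum_(k <oo) g k y)%E.
  move=> Jy; rewrite nneseries_esumT //.
  apply: le_trans (IHd (D `&` [set k | I k y])
    (fun k l => a k (lift ord0 l)) (fun k l => b k (lift ord0 l)) _ _) _.
  - by move=> k l; exact: ab.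
  - move=> x xm.
    have [|k Dk kx] :=
        cov (fun l => if unlift ord0 l is Some l' then x l' else y).
      move=> l; case: unliftP => [l' _|_]; first exact: xm.
      by move: Jy; rewrite /J /= in_itv.
    exists k; last by move=> l; have := kx (lift ord0 l); rewrite liftK.
    by split=> //=; have := kx ord0; rewrite unlift_none /I /= in_itv.
  - rewrite esum_mkcond; apply: le_esum => k _.
    rewrite in_setI /g /c indicE.
    have -> : (k \in [set k | I k y]) = (y \in I k).
      by apply/idP/idP; rewrite !inE.
    by case: (k \in D); case: (y \in I k); rewrite /= ?mule1 ?mule0 ?mul0e.
have -> : 1%E = (\int[lebesgue_measure]_(y in J) (cst 1%E y))%E :> \bar R.
  rewrite integral_cst //= /J lebesgue_measure_itv /= lte_fin ltrDl ltr01.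
  by rewrite -EFinD addrC addKr mule1.
apply: (@le_trans _ _ (\int[lebesgue_measure]_(y in J) \sum_(k <oo) g k y)%E).
  apply: ge0_le_integral => //.
  apply: ge0_emeasurable_sum => // k y _ _; exact: g_ge0.
rewrite integral_nneseries //.
rewrite esum_mkcond -nneseries_esumT; last first.
  move=> k; case: ifP => // _; rewrite lee_fin; apply: prodr_ge0 => l _.
  by rewrite subr_ge0.
apply: lee_nneseries => [k _ _|k _]; first by apply: integral_ge0 => y _.
rewrite ge0_integralZl_EFin //; last first.
  by apply/measurable_EFinP; exact: measurable_indic.
rewrite integral_indic //.
apply: (@le_trans _ _ ((c k)%:E * (b k ord0 - a k ord0)%:E)%E).
  apply: lee_wpmul2l; first by rewrite lee_fin.
  apply: (@le_trans _ _ (lebesgue_measure (I k))).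
    by apply: le_measure; rewrite ?inE //; apply: measurableI.
  rewrite /I lebesgue_measure_itv /=; case: ifP => // _.
  by rewrite lee_fin subr_ge0.
rewrite /c; case: ifP => _; last by rewrite mul0e.
by rewrite -EFinM big_ord_recl mulrC.
Qed.

Lemma lebesgue_null_misses_cube (R : realType) (d : nat) (N : set 'rV[R]_d)
    (m : R) :
  lebesgue_null N ->
  exists2 t : 'rV[R]_d, ~ N t & forall l, m <= t 0 l <= m + 1.
Proof.
move=> null_N; apply/not_exists2P => all_N.
have [D [a [b [ab cov vol]]]] := null_N 1 ltr01.
suff: (1 <= \esum_(k in D) (\prod_l (b k 0 l - a k 0 l))%:E)%E.
  by rewrite leNgt vol.
apply: (@cube_cover_volume_ge1 _ _ m) => // x xm.
have [/contrapT Nx|[]] := all_N (\row_l x l); last by move=> l; rewrite mxE.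
by have [k Dk kx] := cov _ Nx; exists k => // l; have := kx l; rewrite mxE.
Qed.

(** * Diagonal conjugation of characteristic matrices *)

(** Both sides become the scalar matrix \det B when multiplied on the left by
P B Q, which can be cancelled since its determinant is \det B. *)
Lemma adj_conj (K : idomainType) n (P Q B : 'M[K]_n) :
  P *m Q = 1%:M -> \det B != 0 ->
  \adj (P *m B *m Q) = P *m \adj B *m Q.
Proof.
move=> PQ detB; have QP := mulmx1C PQ.
set C := P *m B *m Q.
have detC : \det C = \det B.
  by rewrite !det_mulmx mulrAC -det_mulmx PQ det1 mul1r.
have CX : C *m (P *m \adj B *m Q) = (\det B)%:M.
  rewrite /C !mulmxA -(mulmxA (P *m B) Q P) QP mulmx1 -(mulmxA P B) mul_mx_adj.
  by rewrite mul_mx_scalar -scalemxAl PQ scalemx1.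
apply: (scalemx_inj detB); rewrite -[LHS]mul_mx_scalar -CX.
by rewrite (mulmxA (\adj C)) mul_adj_mx detC mul_scalar_mx.
Qed.

Section DiagonalConjugation.
Variables (K : fieldType) (n : nat) (d : 'I_n -> K) (A : 'M[K]_n).
Hypothesis d_neq0 : forall u, d u != 0.

Let A' := \matrix_(u, v) (d u * A u v / d v).
Let P := map_mx (@polyC K) (diag_mx (\row_u d u)).
Let Q := map_mx (@polyC K) (diag_mx (\row_u (d u)^-1)).

Let PQ : P *m Q = 1%:M.
Proof.
rewrite -map_mxM mul_diag_mx /= -(map_mx1 (@polyC K)); congr map_mx.
apply/matrixP => u v; rewrite !mxE.
by case: eqP => [->|_]; rewrite ?mulr0 // mulr1n divff.
Qed.

Let char_conj : char_poly_mx A' = P *m char_poly_mx A *m Q.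
Proof.
rewrite /char_poly_mx mulmxBr mulmxBl mul_mx_scalar -scalemxAl PQ scalemx1.
rewrite -!map_mxM; congr (_ - map_mx _ _).
by apply/matrixP => u v; rewrite mul_diag_mx mul_mx_diag !mxE.
Qed.

Lemma det_char_diag_conj : \det (char_poly_mx A') = \det (char_poly_mx A).
Proof. by rewrite char_conj !det_mulmx mulrAC -det_mulmx PQ det1 mul1r. Qed.

Lemma cofactor_char_diag_conj u v : d u = d v ->
  cofactor (char_poly_mx A') v u = cofactor (char_poly_mx A) v u.
Proof.
move=> duv; have adjE (B : 'M[{poly K}]_n) : cofactor B v u = (\adj B) u v.
  by rewrite mxE.
rewrite !adjE char_conj adj_conj //; last first.
  exact: monic_neq0 (char_poly_monic A).
rewrite /P /Q !map_diag_mx mul_diag_mx mul_mx_diag !mxE -/(cofactor _ _ _).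
by rewrite mulrAC -polyCM duv divff // mul1r.
Qed.
End DiagonalConjugation.

(** * Parameter changes induced by diagonal conjugations *)

Section CycleRescaling.
Variables (R : realType) (n : nat) (M : lc_model n).
Hypothesis cM : cycle_model M.
Local Notation params := 'rV[R]_(nparams M).

Lemma cycle_edgeE u v : ((u, v) \in edges M) = (v == ordS u).
Proof.
rewrite cM; apply/imsetP/eqP => [[w _ [-> ->]] //|->].
by exists u.
Qed.

Lemma leak_paramE (t : params) v (vL : v \in leaks M) :
  leak_param t v = t 0 (rshift #|edges M| (enum_rank_in vL v)).
Proof.
rewrite /leak_param (big_pred1 (enum_rank_in vL v)) // => l.
apply/eqP/eqP => [lv|->]; last by rewrite enum_rankK_in.
by apply: enum_val_inj; rewrite enum_rankK_in.
Qed.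

Lemma cycle_comp_mxE (t : params) u v :
  comp_mx t u v =
    if u == v then
      (if u \in leaks M then - leak_param t u else 0) - edge_param t (ordS u) u
    else if u == ordS v then edge_param t u v else 0.
Proof.
rewrite mxE cycle_edgeE (big_pred1 (ordS u)) // => q.
exact: cycle_edgeE.
Qed.

(** Conjugation by diag(d) forces the factor d_{v+1} / d_v on the edge parameter
of v -> v+1; the leak parameter of v then has to compensate, because
conjugation fixes the diagonal. *)
Definition rescale (d : 'I_n -> R) (t : params) : params :=
  let r v := d (ordS v) / d v in
  row_mx (\row_l (r (enum_val l).1 * t 0 (lshift #|leaks M| l)))
         (\row_l (let v := enum_val l in
                  t 0 (rshift #|edges M| l)
                  + (1 - r v) * edge_param t (ordS v) v)).

Lemma rescale_edge d t l :
  rescale d t 0 (lshift #|leaks M| l) =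
  d (ordS (enum_val l).1) / d (enum_val l).1 * t 0 (lshift #|leaks M| l).
Proof. by rewrite row_mxEl mxE. Qed.

Lemma rescale_leak d t l :
  rescale d t 0 (rshift #|edges M| l) =
  t 0 (rshift #|edges M| l) +
  (1 - d (ordS (enum_val l)) / d (enum_val l)) *
    edge_param t (ordS (enum_val l)) (enum_val l).
Proof. by rewrite row_mxEr mxE. Qed.

Lemma edge_param_rescale d t v :
  edge_param (rescale d t) (ordS v) v =
  d (ordS v) / d v * edge_param t (ordS v) v.
Proof.
rewrite /edge_param mulr_sumr; apply: eq_bigr => l /eqP lv.
by rewrite rescale_edge lv.
Qed.

Lemma leak_param_rescale d t v : v \in leaks M ->
  leak_param (rescale d t) v =
  leak_param t v + (1 - d (ordS v) / d v) * edge_param t (ordS v) v.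
Proof. by move=> vL; rewrite !leak_paramE rescale_leak enum_rankK_in. Qed.

Variable d : 'I_n -> R.
Hypothesis d_neq0 : forall v, d v != 0.
Hypothesis d_leak : forall v, v \notin leaks M -> d (ordS v) = d v.

(** A compartment without leak has no parameter that could compensate a change
of its edge parameter on the diagonal, so d may not jump there. *)
Lemma comp_mx_rescale t :
  comp_mx (rescale d t) = \matrix_(u, v) (d u * comp_mx t u v / d v).
Proof.
apply/matrixP => u v; rewrite [in RHS]mxE !cycle_comp_mxE.
case: (eqVneq u v) => [<-{v}|neq_uv].
  rewrite mulrAC divff // mul1r edge_param_rescale.
  case: ifPn => uL; last by rewrite d_leak // divff // mul1r.
  by rewrite leak_param_rescale // opprD mulrBl mul1r; ring.
case: (eqVneq u (ordS v)) => [->|_]; last by rewrite mulr0 mul0r.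
by rewrite edge_param_rescale mulrAC.
Qed.

(** The right-hand side of the input-output equation is the (p, q) entry of the
adjugate, which conjugation multiplies by d p / d q. *)
Lemma coefficient_map_rescale (p q : 'I_n) t :
  inputs M = [set q]%SET -> outputs M = [set p]%SET -> d p = d q ->
  coefficient_map (rescale d t) = coefficient_map t.
Proof.
move=> inM outM dpq.
have lhsE : io_lhs (rescale d t) = io_lhs t.
  by rewrite /io_lhs comp_mx_rescale det_char_diag_conj.
have rhsE : io_rhs p q (rescale d t) = io_rhs p q t.
  by rewrite /io_rhs comp_mx_rescale cofactor_char_diag_conj.
have : all (fun f : params -> R => f (rescale d t) == f t) (kept_coefs R M).
  rewrite /kept_coefs /io_coefs all_filter; apply: sub_all (_ : all _ _).
    by move=> f ft; apply/implyP => _; exact: ft.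
  rewrite all_cat; apply/andP; split.
    by apply/all_allpairsP => i k _ _; rewrite lhsE.
  apply/all_allpairsP => -[i j] k /=.
  rewrite mem_enum outM inM !inE /= => /andP[/eqP-> /eqP->] _.
  by rewrite rhsE.
move/(all_nthP (fun=> 0)) => coefE; apply/rowP => l; rewrite !mxE.
by apply/eqP/coefE.
Qed.
End CycleRescaling.

(** * The curve through a parameter vector *)

Section ArcScaling.
Variables (R : realType) (n : nat) (M : lc_model n).
Local Notation params := 'rV[R]_(nparams M).

Definition arc_scaling (i j : nat) (s : R) (v : 'I_n) : R :=
  if (i < v <= j)%N then s else 1.

(** Since i < j, the arc i+1, ..., j does not wrap around the cycle: it is
entered only by the edge leaving i and left only by the edge leaving j. *)
Lemma arc_scaling_ordS (i j : 'I_n) s v : (i < j)%N -> v != i -> v != j ->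
  arc_scaling i j s (ordS v) = arc_scaling i j s v.
Proof.
move=> ij; rewrite -!val_eqE /arc_scaling /= => vi vj.
have := ltn_ord v; rewrite leq_eqVlt => /orP[/eqP vn|vn].
  have jn := ltn_ord j.
  rewrite vn modnn ltn0; case: ifP => //; lia.
rewrite modn_small //; congr (if _ then _ else _); lia.
Qed.

Lemma rescale_continuous_at1 (i j : nat) (t : params) :
  rescale (arc_scaling i j s) t @[s --> (1 : R)] --> t.
Proof.
have dcvg v : arc_scaling i j s v @[s --> (1 : R)] --> (1 : R).
  by rewrite /arc_scaling; case: (i < v <= j)%N; [exact: cvg_id|exact: cvg_cst].
have rcvg v : arc_scaling i j s (ordS v) / arc_scaling i j s v
    @[s --> (1 : R)] --> (1 : R).
  rewrite -[X in _ --> X]divr1; apply: cvgM => //.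
  by apply: cvgV; rewrite ?oner_neq0.
apply/cvg_ballP => e e0.
suff : \forall s \near (1 : R), forall l,
    ball (t 0 l) e (rescale (arc_scaling i j s) t 0 l).
  apply: filterS => s sl; split=> // k l; rewrite !ord1; exact: sl.
apply: (@filter_forall _ _ (fun l s =>
  ball (t 0 l) e (rescale (arc_scaling i j s) t 0 l)) (nbhs (1 : R)) _) => l.
suff : rescale (arc_scaling i j s) t 0 l @[s --> (1 : R)] --> t 0 l.
  by move/cvg_ballP; apply.
rewrite -(splitK l); case: (fintype.split l) => l' /=.
  under eq_fun do rewrite rescale_edge.
  set v := (enum_val l').1; set x := t 0 _.
  suff : arc_scaling i j s (ordS v) / arc_scaling i j s v * x
      @[s --> (1 : R)] --> 1 * x by rewrite mul1r.
  by apply: cvgM; [exact: rcvg|exact: cvg_cst].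
under eq_fun do rewrite rescale_leak.
set v := enum_val l'; set x := t 0 _.
set k := edge_param _ _ _.
suff : x + (1 - arc_scaling i j s (ordS v) / arc_scaling i j s v) * k
    @[s --> (1 : R)] --> x + (1 - 1) * k.
  by rewrite subrr mul0r addr0.
apply: cvgD; first exact: cvg_cst.
apply: cvgM; last exact: cvg_cst.
by apply: cvgB; [exact: cvg_cst|exact: rcvg].
Qed.

End ArcScaling.

Theorem theorem3p11 (R : realType) (n : nat) (M : lc_model n) (p : 'I_n) :
  (3 <= n)%N ->
  cycle_model M ->
  inputs M = [set i : 'I_n | nat_of_ord i == 0%N]%SET ->
  outputs M = [set p]%SET ->
  (exists i j : 'I_n,
     [/\ i \in leaks M, j \in leaks M, i != j, (p <= i)%N & (p <= j)%N]) ->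
  ~ generically_locally_identifiable R M.
Proof.
move=> _ cM inM outM [i0 [j0 [i0L j0L ij0 pi0 pj0]]] [N null_N inj_N].
(* Order the two leaks along the path from 1 to n. *)
have [i [j [iL jL ij pi]]] : exists i j : 'I_n,
    [/\ i \in leaks M, j \in leaks M, (i < j)%N & (p <= i)%N].
  case: (ltngtP i0 j0) ij0 => [ij _|ij _|/val_inj -> /eqP //].
    by exists i0, j0.
  by exists j0, i0.
pose q := Ordinal (leq_ltn_trans (leq0n p) (ltn_ord p)).
have inMq : inputs M = [set q]%SET.
  by rewrite inM; apply/setP => v; rewrite !inE.
(* The cube [1, 2]^d stays away from the hyperplane k_{i+1,i} = 0. *)
have [t Nt tge1] := lebesgue_null_misses_cube 1 null_N.
have [U [openU Ut injU]] := inj_N t Nt.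
have iE : (i, ordS i) \in edges M by rewrite cycle_edgeE.
pose l := lshift #|leaks M| (enum_rank_in iE (i, ordS i)).
have tl : t 0 l != 0 by have /andP[/(lt_le_trans ltr01)/lt0r_neq0] := tge1 l.
have near1 : \forall s \near (1 : R)^', U (rescale (arc_scaling i j s) t).
  apply: cvg_within; have /(_ U) := @rescale_continuous_at1 _ _ _ i j t.
  by apply; exact: open_nbhs_nbhs.
(* Any s <> 1 close to 1 contradicts injectivity on U, and such s exist. *)
have : \forall s \near (1 : R)^', False.
  near=> s.
  have s_neq1 : s != 1 by near: s; exact: nbhs_dnbhs_neq.
  have s_neq0 : s != 0.
    near: s; apply: cvg_within; apply: open_nbhs_nbhs; split => /=.
      exact: open_neq.
    exact: oner_neq0.
  have Us : U (rescale (arc_scaling i j s) t) by near: s.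
  have d_neq0 (v : 'I_n) : arc_scaling i j s v != 0.
    by rewrite /arc_scaling; case: ifP => _ //; exact: oner_neq0.
  have : rescale (arc_scaling i j s) t = t.
    apply: injU; rewrite ?inE //.
    apply: (coefficient_map_rescale cM d_neq0 _ _ inMq outM).
      move=> v vL; apply: arc_scaling_ordS => //.
        by apply: contraNneq vL => ->.
      by apply: contraNneq vL => ->.
    by rewrite /arc_scaling /= ltnNge pi.
  (* The parameter of the edge leaving i has been multiplied by s. *)
  move/matrixP/(_ 0 l); rewrite rescale_edge enum_rankK_in // -/l /=.
  rewrite /arc_scaling /= modn_small ?(leq_ltn_trans ij) // ltnn ltnSn ij /=.
  rewrite divr1 => /(canRL (mulfK tl)); rewrite divff // => /eqP.
  by rewrite (negPf s_neq1).
by move/filter_ex => -[].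
Unshelve. all: by end_near.
Qed.
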